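(* Let $T_n^1$ and $T_n^2$ be two independent uniform attachment trees with $n$ vertices each, and let $X_n$ be the number of vertices of their largest common (unlabeled) subtree. For every $n \geq 1$, $$\mathbb{E}[X_n] \geq n^{\log_2(5/4)} \geq n^{0.32}.$$
   Context: A uniform attachment tree (random recursive tree) is defined recursively: $T_1$ is a single vertex, and given $T_n$, the tree $T_{n+1}$ is obtained by adding one new vertex and joining it by a single edge to a vertex of $T_n$ chosen uniformly at random, independently of everything else. For two finite trees $T^1,T^2$ (viewed as unlabeled, unrooted graphs), the size of their largest common subtree is the maximum of $|S|$ (number of vertices of $S$) over all trees $S$ such that $S$ is isomorphic to a subtree (connected subgraph) of $T^1$ and to a subtree of $T^2$; $X_n$ is this quantity for $T_n^1$ and $T_n^2$. *)

(* Defs.v *)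
From mathcomp Require Import all_boot all_order all_algebra.
From mathcomp Require Import all_classical all_reals all_analysis.

Set Implicit Arguments.
Unset Strict Implicit.
Unset Printing Implicit Defensive.

Import Order.TTheory GRing.Theory Num.Theory.

Local Open Scope ring_scope.

(* A vertex set and an edge set inside an ambient finite type, so that a graph
   and its subgraphs have the same type; [is_graph] makes it a simple graph. *)
Notation graph V := ({set V} * {set {set V}})%type.

Section Graphs.
Variable V : finType.
Implicit Types G H : graph V.

Definition verts G : {set V} := G.1.
Definition edges G : {set {set V}} := G.2.

Definition is_graph G : bool :=
  [forall e in edges G, (e \subset verts G) && (#|e| == 2)%N].

Definition adj G : rel V := fun x y => (x != y) && ([set x; y] \in edges G).

Definition graph_connected G : Prop :=
  verts G != finset.set0 /\
  {in verts G &, forall x y, connect (adj G) x y}.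

Definition acyclic G : Prop :=
  forall c : seq V, (2 < size c)%N -> uniq c -> ~~ cycle (adj G) c.

Definition is_tree G : Prop :=
  [/\ is_graph G, graph_connected G & acyclic G].

Definition subgraph H G : Prop :=
  [/\ is_graph H, verts H \subset verts G & edges H \subset edges G].

Definition subtree H G : Prop := subgraph H G /\ graph_connected H.

End Graphs.

Definition graph_iso (U V : finType) (G : graph U) (H : graph V) : Prop :=
  exists f : U -> V,
    [/\ {in verts G &, injective f},
        [set f x | x in verts G]%SET = verts H &
        {in verts G &, forall x y, adj H (f x) (f y) = adj G x y}].

Definition common_subtree (U V W : finType) (S : graph U)
    (G : graph V) (H : graph W) : Prop :=
  [/\ is_tree S,
      exists2 G' : graph V, subtree G' G & graph_iso S G' &
      exists2 H' : graph W, subtree H' H & graph_iso S H'].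

(* The bound on [k] loses nothing: a common subtree has at most as many
   vertices as [G]. *)
Definition largest_common_subtree (V W : finType)
    (G : graph V) (H : graph W) : nat :=
  \max_(k < #|verts G|.+1 |
        `[< exists (U : finType) (S : graph U),
              common_subtree S G H /\ #|verts S| = k >]) k.

Definition single_vertex : graph 'I_1 := ([set: 'I_1]%SET, finset.set0).

(* The vertices of [H] keep their numbers; the new vertex is [ord_max]. *)
Definition attach (m : nat) (H : graph 'I_m) (v : 'I_m) : graph 'I_m.+1 :=
  let old := widen_ord (leqnSn m) in
  ((ord_max |: [set old x | x in verts H])%SET,
   ([set old v; ord_max]
      |: [set [set old x | x in e] | e : {set 'I_m} in edges H])%SET).

Section UniformAttachment.
Variable R : realType.

(* Probability that attaching a new vertex to a uniform vertex of [H]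
   produces [G]. *)
Definition attach_prob (m : nat) (H : graph 'I_m) (G : graph 'I_m.+1) : R :=
  #|[set v in verts H | attach H v == G]%SET|%:R / #|verts H|%:R.

(* Probability mass function of the uniform attachment tree on [m.+1] vertices,
   numbered by order of arrival. *)
Fixpoint ua_law_succ (m : nat) : graph 'I_m.+1 -> R :=
  match m with
  | 0 => fun G => (G == single_vertex)%:R
  | k.+1 => fun G => \sum_(H : graph 'I_k.+1) ua_law_succ H * attach_prob H G
  end.

(* The same indexed by the number of vertices; the value at [n = 0], where
   there is no tree, is junk. *)
Definition ua_law (n : nat) : graph 'I_n -> R :=
  match n with
  | 0 => fun=> 0
  | m.+1 => @ua_law_succ m
  end.

Variables (d : measure_display) (Omega : measurableType d).
Variable P : probability Omega R.

Definition uniform_attachment_tree (n : nat) (T : Omega -> graph 'I_n) : Prop :=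
  (forall A : set (graph 'I_n), measurable (T @^-1` A)%classic) /\
  (forall G, P (T @^-1` [set G])%classic = (ua_law G)%:E).

Definition independent_rv (A B : Type) (X : Omega -> A) (Y : Omega -> B) :
    Prop :=
  forall (C : set A) (D : set B),
    measurable (X @^-1` C)%classic -> measurable (Y @^-1` D)%classic ->
    P (X @^-1` C `&` Y @^-1` D)%classic =
      (P (X @^-1` C)%classic * P (Y @^-1` D)%classic)%E.

End UniformAttachment.

Definition log2 (R : realType) (x : R) : R := ln x / ln 2.

(* Main.v *)
Require Import Defs.
From mathcomp Require Import all_boot all_order all_algebra.
From mathcomp Require Import all_classical all_reals all_analysis.
From mathcomp Require Import measurable_realfun.
From mathcomp Require Import ring lra zify.

Set Implicit Arguments.
Unset Strict Implicit.
Unset Printing Implicit Defensive.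

Import Order.TTheory GRing.Theory Num.Theory.

Local Open Scope ring_scope.

(**
  Cut a uniform attachment tree at the edge between its first two vertices.  The
  number of vertices on either side is uniform, and given these numbers the two
  sides are independent uniform attachment trees (lemma [avg_join]).  Do this in
  both trees.  A common subtree of the two sides that contain the first vertex
  and a common subtree of the two other sides, both containing the roots and
  matching root with root, are joined by the cut edges into a common subtree of
  the whole trees.  Iterating the cut on both pairs of sides yields a common
  subtree, whose size is called the overlap below, and whose mean [M] satisfies
  an exact recursion (lemma [mean_overlap_rec]): for trees with [n] and [m]
  vertices, [M n m] is twice the mean of [M K L], with [K] uniform on
  [1, .., n - 1] and [L] uniform on [1, .., m - 1], independently.

  For a power [n ^ a], the recursion is consistent with a lower bound as soon as
  twice the mean of [min U V ^ a], with [U] and [V] independent and uniform on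
  the unit interval, is at least [1]; this mean is [2 / ((a + 1) (a + 2))].  The
  exponent [a = 1/3] leaves enough room for the discretization (lemmas
  [cbrt_sum_min_le] and [mean_overlap_ge]), and it exceeds [log2 (5 / 4)]
  because [(5 / 4) ^ 3 <= 2].

  The overlap is computed on unlabelled binary terms that encode the iterated
  cuts.  Lemma [avg_le_ua_law] transfers averages over these terms to the law of
  the attachment tree, and lemma [overlap_le_largest] turns an overlap into a
  common subtree in the sense of graphs.
*)

(** * Rooted trees as binary terms *)

(** A rooted tree cut at the edge between the root and its oldest child: in
    [Join a b], the root of [b] hangs below the root of [a], which stays the
    root.  The leaves of the binary term are exactly the vertices of the tree,
    so attaching a vertex to a tree is replacing one leaf by a [Join] of two
    leaves. *)
Inductive rtree (L : Type) := Vertex of L | Join of rtree L & rtree L.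

Section Trees.
Variable L : Type.
Implicit Types t : rtree L.

Fixpoint labels t : seq L :=
  match t with Vertex x => [:: x] | Join a b => labels a ++ labels b end.

Fixpoint root t : L :=
  match t with Vertex x => x | Join a _ => root a end.

Fixpoint arcs t : seq (L * L) :=
  match t with
  | Vertex _ => [::]
  | Join a b => (root a, root b) :: arcs a ++ arcs b
  end.

Lemma labels_root t : labels t = root t :: behead (labels t).
Proof. by elim: t => //= a -> b _. Qed.

End Trees.

Fixpoint relabel (L M : Type) (f : L -> M) (t : rtree L) : rtree M :=
  match t with
  | Vertex x => Vertex (f x)
  | Join a b => Join (relabel f a) (relabel f b)
  end.

Lemma labels_relabel (L M : Type) (f : L -> M) t :
  labels (relabel f t) = map f (labels t).
Proof. by elim: t => //= a -> b ->; rewrite map_cat. Qed.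

Lemma root_relabel (L M : Type) (f : L -> M) t :
  root (relabel f t) = f (root t).
Proof. by elim: t. Qed.

Lemma arcs_relabel (L M : Type) (f : L -> M) t :
  arcs (relabel f t) = [seq (f e.1, f e.2) | e <- arcs t].
Proof. by elim: t => //= a -> b ->; rewrite !root_relabel map_cat. Qed.

Section Arcs.
Variable L : eqType.
Implicit Types t : rtree L.

Lemma root_in_labels t : root t \in labels t.
Proof. by rewrite labels_root mem_head. Qed.

(** Every vertex but the root is the child of exactly one arc. *)
Lemma perm_labels_arcs t : perm_eq (root t :: unzip2 (arcs t)) (labels t).
Proof.
elim: t => //= a IHa b IHb; rewrite /unzip2 map_cat.
apply: perm_trans (perm_cat IHa IHb); rewrite /= perm_cons.
by rewrite -cat1s perm_catCA.
Qed.

Lemma arcs_labels t p c : (p, c) \in arcs t ->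
  (p \in labels t) && (c \in labels t).
Proof.
elim: t => //= a IHa b IHb; rewrite in_cons mem_cat !mem_cat.
case/or3P => [/eqP[-> ->]|/IHa/andP[-> ->]|/IHb/andP[-> ->]];
  by rewrite ?root_in_labels ?orbT.
Qed.

(** The order of [labels] lists parents before their children, so the position
    in it serves as a rank that orients the edges of the tree. *)
Lemma arcs_index t p c : uniq (labels t) -> (p, c) \in arcs t ->
  (index p (labels t) < index c (labels t))%N.
Proof.
elim: t => //= a IHa b IHb; rewrite cat_uniq => /and3P[ua dis ub].
have nb x : x \in labels b -> x \in labels a = false.
  by move=> xb; apply/negbTE; apply: contra dis => xa; apply/hasP; exists x.
rewrite in_cons mem_cat !index_cat.
case/or3P => [/eqP[-> ->]|e|e].
- rewrite root_in_labels (nb _ (root_in_labels b)).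
  by rewrite ltn_addr // index_mem root_in_labels.
- by have /andP[-> ->] := arcs_labels e; exact: IHa.
- have /andP[pb cb] := arcs_labels e.
  by rewrite !nb // ltn_add2l; exact: IHb.
Qed.

Lemma arcs_parent_inj t p q c : uniq (labels t) ->
  (p, c) \in arcs t -> (q, c) \in arcs t -> p = q.
Proof.
rewrite -(perm_uniq (perm_labels_arcs t)) /= => /andP[_].
elim: (arcs t) => //= -[r d] s IH /andP[ds us]; rewrite !in_cons.
have inS x : (x, d) \notin s by apply: contra ds => /(map_f snd).
case/orP => [/eqP[-> ->]|pc].
  by case/orP => [/eqP[->]|qc] //; rewrite (negbTE (inS _)) in qc.
case/orP => [/eqP[_ e]|qc]; last exact: IH.
by move: pc; rewrite e (negbTE (inS _)).
Qed.

End Arcs.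

(** * The graph of a term is a tree *)

(** A vertex of highest rank on a cycle has two distinct neighbours on the
    cycle, neither of higher rank. *)
Lemma acyclic_rank (V : finType) (G : graph V) (r : V -> nat) :
  (forall x y z, adj G x y -> adj G x z ->
     (r y <= r x)%N -> (r z <= r x)%N -> y = z) -> acyclic G.
Proof.
move=> inj c c3 uc; apply/negP => cyc.
have sy x y : adj G x y = adj G y x by rewrite /adj eq_sym finset.setUC.
have [x0 x0c] : exists x0, x0 \in c.
  by case: c c3 {uc cyc} => // x0 c _; exists x0; rewrite mem_head.
have [x xc xmax] : exists2 x, x \in c & forall y, y \in c -> (r y <= r x)%N.
  by case: (@arg_maxnP _ x0 (mem c) r x0c) => x ? ?; exists x.
have [i p E] := rot_to xc.
have inc y : y \in x :: p -> y \in c by rewrite -E mem_rot.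
have := cyc; rewrite -(rot_cycle i) E.
have := uc; rewrite -(rot_uniq i) E.
have := c3; rewrite -(size_rot i) E.
case: p E inc => [//|y p]; case/lastP: p => [//|p z] E inc _ /= u.
rewrite rcons_path last_rcons => /and3P[xy _ zx].
have yz : y = z.
  apply: (inj x) => //; first by rewrite sy.
  - by apply/xmax/inc; rewrite !in_cons eqxx orbT.
  - by apply/xmax/inc; rewrite !in_cons mem_rcons mem_head !orbT.
by move: u; rewrite yz mem_rcons mem_head /= andbF.
Qed.

Definition graph_of (V : finType) (t : rtree V) : graph V :=
  ([set x in labels t]%SET, [set [set e.1; e.2] | e in arcs t]%SET).

Section GraphOf.
Variable V : finType.
Implicit Types t : rtree V.

Lemma in_verts t x : (x \in verts (graph_of t)) = (x \in labels t).
Proof. by rewrite inE. Qed.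

Lemma card_verts t : uniq (labels t) ->
  #|verts (graph_of t)| = size (labels t).
Proof. by move=> u; rewrite cardsE; apply/card_uniqP. Qed.

Lemma arc_neq t p c : uniq (labels t) -> (p, c) \in arcs t -> p != c.
Proof.
by move=> u /(arcs_index u) lt; apply: contraTneq lt => ->; rewrite ltnn.
Qed.

Lemma adj_graph_of t x y : uniq (labels t) ->
  adj (graph_of t) x y = ((x, y) \in arcs t) || ((y, x) \in arcs t).
Proof.
move=> u; apply/andP/orP.
- case=> xy /imsetP[[p c] e /= E].
  have xpc : x \in [set p; c]%SET by rewrite -E set21.
  have ypc : y \in [set p; c]%SET by rewrite -E set22.
  move: xpc ypc xy; rewrite !inE.
  by case/orP => /eqP->; case/orP => /eqP->; rewrite ?eqxx // => _;
    [left|right].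
- case=> e; split; rewrite ?(arc_neq u e) //.
  + by apply/imsetP; exists (x, y).
  + by rewrite eq_sym (arc_neq u e).
  + by apply/imsetP; exists (y, x) => //=; rewrite finset.setUC.
Qed.

Lemma graph_of_graph t : uniq (labels t) -> is_graph (graph_of t).
Proof.
move=> u; apply/forall_inP => e /imsetP[[p c] pc ->] /=.
have /andP[pt ct] := arcs_labels pc.
rewrite cards2 (arc_neq u pc) andbT.
by apply/fintype.subsetP => x; rewrite !inE => /orP[] /eqP->.
Qed.

Lemma graph_of_connected t : uniq (labels t) -> graph_connected (graph_of t).
Proof.
move=> u; split.
  by apply/set0Pn; exists (root t); rewrite in_verts root_in_labels.
have sy : connect_sym (adj (graph_of t)).
  by apply: sym_connect_sym => x y; rewrite /adj eq_sym finset.setUC.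
have from_root x : x \in labels t -> connect (adj (graph_of t)) (root t) x.
  move=> {sy}; elim: t u x => [y|a IHa b IHb] /= u x.
    by rewrite inE => /eqP->; exact: connect0.
  have [ua ub] : uniq (labels a) /\ uniq (labels b).
    by move: u; rewrite cat_uniq => /and3P[].
  rewrite mem_cat => /orP[xa|xb].
    apply: connect_sub (IHa ua _ xa) => y z yz; apply: connect1.
    move: yz; rewrite !adj_graph_of //= !in_cons !mem_cat.
    by case/orP => ->; rewrite !orbT.
  apply: (@connect_trans _ _ (root b)).
    by apply: connect1; rewrite adj_graph_of //= mem_head.
  apply: connect_sub (IHb ub _ xb) => y z yz; apply: connect1.
  move: yz; rewrite !adj_graph_of //= !in_cons !mem_cat.
  by case/orP => ->; rewrite !orbT.
move=> x y; rewrite !in_verts => xt yt.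
by apply: (@connect_trans _ _ (root t)); [rewrite sy|]; exact: from_root.
Qed.

(** A neighbour that comes earlier in the order of [labels] is the parent, which
    is unique; this rules out cycles. *)
Lemma graph_of_tree t : uniq (labels t) -> is_tree (graph_of t).
Proof.
move=> u; split; [exact: graph_of_graph|exact: graph_of_connected|].
apply: (@acyclic_rank _ _ (fun x => index x (labels t))) => x y z.
have up w : adj (graph_of t) x w ->
    (index w (labels t) <= index x (labels t))%N -> (w, x) \in arcs t.
  rewrite adj_graph_of // => /orP[|//] /(arcs_index u).
  by rewrite ltnNge => /negbTE->.
by move=> xy xz /(up _ xy) yx /(up _ xz) zx; exact: arcs_parent_inj yx zx.
Qed.

Lemma graph_of_subtree t s : uniq (labels t) -> uniq (labels s) ->
  {subset labels s <= labels t} -> {subset arcs s <= arcs t} ->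
  subtree (graph_of s) (graph_of t).
Proof.
move=> ut us sl sa; split; last exact: graph_of_connected.
split; first exact: graph_of_graph.
- by apply/fintype.subsetP => x; rewrite !in_verts; exact: sl.
- by apply: imsetS; apply/fintype.subsetP => e; exact: sa.
Qed.

End GraphOf.

Lemma graph_iso_relabel (U V : finType) (f : U -> V) (t : rtree U) :
  uniq (map f (labels t)) -> graph_iso (graph_of t) (graph_of (relabel f t)).
Proof.
move=> u; have ut := map_uniq u.
have finj : {in labels t &, injective f}.
  move: u {ut}; elim: (labels t) => //= x s IH /andP[xs us] y z.
  rewrite !in_cons; case/orP => [/eqP->|ys]; case/orP => [/eqP->|zs] //.
  - by move=> e; move: xs; rewrite e map_f.
  - by move=> e; move: xs; rewrite -e map_f.
  - exact: IH.
exists f; split.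
- by move=> x y; rewrite !in_verts; exact: finj.
- apply/setP => y; rewrite in_verts labels_relabel.
  apply/imsetP/mapP => -[x xt ->]; exists x => //; move: xt;
    by rewrite in_verts.
- move=> x y; rewrite !in_verts => xt yt.
  have arcE p c : p \in labels t -> c \in labels t ->
      ((f p, f c) \in [seq (f e.1, f e.2) | e <- arcs t]) = ((p, c) \in arcs t).
    move=> pt ct; apply/mapP/idP => [[[q d] e /= [pq cd]]|e]; last first.
      by exists (p, c).
    have /andP[qt dt] := arcs_labels e.
    by rewrite (finj _ _ pt qt pq) (finj _ _ ct dt cd).
  rewrite !adj_graph_of ?labels_relabel //.
  by rewrite arcs_relabel !arcE.
Qed.

(** * Superposing two trees *)

(** The superposition that follows the cuts.  It need not be the largest one,
    but its size adds up over the two sides of the cut.  The labels record the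
    pair of vertices that were superposed, so the two projections embed it into
    both trees. *)
Fixpoint common (L M : Type) (t : rtree L) (s : rtree M) : rtree (L * M) :=
  match t, s with
  | Join a b, Join c d => Join (common a c) (common b d)
  | _, _ => Vertex (root t, root s)
  end.

Definition overlap (L M : Type) (t : rtree L) (s : rtree M) : nat :=
  size (labels (common t s)).

Lemma root_common (L M : Type) (t : rtree L) (s : rtree M) :
  root (common t s) = (root t, root s).
Proof. by elim: t s => [x|a IHa b IHb] [y|c d] //=; rewrite IHa. Qed.

Lemma common_relabel (L M L' M' : Type) (f : L -> L') (g : M -> M') t s :
  common (relabel f t) (relabel g s) =
  relabel (fun p => (f p.1, g p.2)) (common t s).
Proof.
by elim: t s => [x|a IHa b IHb] [y|c d] //=; rewrite ?root_relabel ?IHa ?IHb.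
Qed.

Lemma overlap_relabel (L M L' M' : Type) (f : L -> L') (g : M -> M') t s :
  overlap (relabel f t) (relabel g s) = overlap t s.
Proof. by rewrite /overlap common_relabel labels_relabel size_map. Qed.

Lemma overlap_vertexl (L M : Type) x (s : rtree M) :
  overlap (Vertex (x : L)) s = 1.
Proof. by case: s. Qed.

Lemma overlap_vertexr (L M : Type) (t : rtree L) y :
  overlap t (Vertex (y : M)) = 1.
Proof. by case: t. Qed.

Lemma overlap_join (L M : Type) (a b : rtree L) (c d : rtree M) :
  overlap (Join a b) (Join c d) = (overlap a c + overlap b d)%N.
Proof. by rewrite /overlap /= size_cat. Qed.

Lemma common_embeds_left (L M : eqType) (t : rtree L) (s : rtree M) :
  subseq (map fst (labels (common t s))) (labels t) /\
  {subset [seq (e.1.1, e.2.1) | e <- arcs (common t s)] <= arcs t}.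
Proof.
have v (u : rtree L) : subseq [:: root u] (labels u).
  by rewrite sub1seq root_in_labels.
elim: t s => [x|a IHa b IHb] [y|c d]; split=> //=; rewrite ?eqxx //.
- exact: (v (Join a b)).
- by rewrite map_cat; apply: cat_subseq; [case: (IHa c)|case: (IHb d)].
- move=> e; rewrite !root_common /= !in_cons map_cat !mem_cat.
  case/or3P => [->//|/(proj2 (IHa c))->|/(proj2 (IHb d))->];
    by rewrite !orbT.
Qed.

Lemma common_embeds_right (L M : eqType) (t : rtree L) (s : rtree M) :
  subseq (map snd (labels (common t s))) (labels s) /\
  {subset [seq (e.1.2, e.2.2) | e <- arcs (common t s)] <= arcs s}.
Proof.
have v (u : rtree M) : subseq [:: root u] (labels u).
  by rewrite sub1seq root_in_labels.
elim: t s => [x|a IHa b IHb] [y|c d]; split=> //=; rewrite ?eqxx //.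
- exact: (v (Join c d)).
- by rewrite map_cat; apply: cat_subseq; [case: (IHa c)|case: (IHb d)].
- move=> e; rewrite !root_common /= !in_cons map_cat !mem_cat.
  case/or3P => [->//|/(proj2 (IHa c))->|/(proj2 (IHb d))->];
    by rewrite !orbT.
Qed.

Lemma iso_subtree_relabel (U V : finType) (f : U -> V)
    (t : rtree U) (s : rtree V) :
  uniq (labels s) -> subseq (map f (labels t)) (labels s) ->
  {subset [seq (f e.1, f e.2) | e <- arcs t] <= arcs s} ->
  exists2 G, subtree G (graph_of s) & graph_iso (graph_of t) G.
Proof.
move=> us sl sa; have ut := subseq_uniq sl us.
exists (graph_of (relabel f t)); last exact: graph_iso_relabel.
apply: graph_of_subtree; rewrite ?labels_relabel ?arcs_relabel //.
exact: mem_subseq.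
Qed.

(** The superposition of the two trees is itself a tree on pairs of vertices,
    and each projection is injective on it because the image labels form a
    subsequence of the duplicate-free labels of the tree. *)
Lemma overlap_le_largest (V W : finType) (t : rtree V) (s : rtree W) :
  uniq (labels t) -> uniq (labels s) ->
  (overlap t s <= largest_common_subtree (graph_of t) (graph_of s))%N.
Proof.
move=> ut us.
have [l1 a1] := common_embeds_left t s; have [l2 a2] := common_embeds_right t s.
have uc := map_uniq (subseq_uniq l1 ut).
have le : (overlap t s < #|verts (graph_of t)|.+1)%N.
  by rewrite ltnS card_verts // /overlap -(size_map fst); exact: size_subseq.
apply: (leq_trans _ (leq_bigmax_cond (Ordinal le) _)) => //.
apply/asboolP; exists (V * W)%type, (graph_of (common t s)).
split; last exact: card_verts.
split; first exact: graph_of_tree.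
- exact: iso_subtree_relabel l1 a1.
- exact: iso_subtree_relabel l2 a2.
Qed.

(** * Averages over growth histories *)

(** The trees obtained by attaching one vertex, in the order of the vertices
    that receive it. *)
Fixpoint growths (t : rtree unit) : seq (rtree unit) :=
  match t with
  | Vertex _ => [:: Join t t]
  | Join a b =>
      [seq Join x b | x <- growths a] ++ [seq Join a x | x <- growths b]
  end.

(** All growth histories with [m] attachments, with repetition: a shape appears
    once for each history that leads to it.  The list has [m`!] entries on
    [m.+1] vertices each, and a uniform entry is the shape of the uniform
    attachment tree. *)
Fixpoint trees (m : nat) : seq (rtree unit) :=
  match m with
  | 0 => [:: Vertex tt]
  | k.+1 => flatten [seq growths t | t <- trees k]
  end.

Section Average.
Variable R : realType.
Implicit Types F G : rtree unit -> R.

Definition avg (m : nat) F : R := (\sum_(t <- trees m) F t) / (m`!)%:R.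

Lemma eq_avg m F G : F =1 G -> avg m F = avg m G.
Proof. by move=> e; rewrite /avg; under eq_bigr do rewrite e. Qed.

Lemma avgD m F G : avg m (fun t => F t + G t) = avg m F + avg m G.
Proof. by rewrite /avg big_split mulrDl. Qed.

Lemma avgZ m (c : R) F : avg m (fun t => c * F t) = c * avg m F.
Proof. by rewrite /avg -mulr_sumr mulrA. Qed.

Lemma avg_sum m n (F : 'I_n -> rtree unit -> R) :
  avg m (fun t => \sum_(i < n) F i t) = \sum_(i < n) avg m (F i).
Proof. by rewrite /avg exchange_big mulr_suml. Qed.

Lemma avg0 F : avg 0 F = F (Vertex tt).
Proof. by rewrite /avg big_seq1 fact0 divr1. Qed.

Lemma avgS m F :
  avg m.+1 F = avg m (fun t => (m.+1)%:R^-1 * \sum_(x <- growths t) F x).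
Proof.
rewrite avgZ /avg /= big_flatten big_map factS natrM invfM.
by rewrite [LHS]mulrCA.
Qed.

(** The splitting property.  The side of the cut that receives the next vertex
    is chosen with probability proportional to its size, as in a Polya urn
    started from one vertex on each side: the sizes stay uniform, and given
    them both sides grow as independent uniform attachment trees. *)
Lemma avg_join m F :
  avg m.+1 F = (m.+1)%:R^-1 *
    \sum_(i < m.+1) avg i (fun a => avg (m - i) (fun b => F (Join a b))).
Proof.
elim: m F => [|m IH] F.
  by rewrite avgS avg0 /= big_seq1 big_ord1 !avg0.
(* The average over trees cut into sides with [i] and [j] attachments. *)
pose W i j := avg i (fun a => avg j (fun b => F (Join a b))).
have WS i j n : avg i (fun a => avg j (fun b =>
      n%:R^-1 * \sum_(x <- growths (Join a b)) F x)) =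
    n%:R^-1 * (i.+1%:R * W i.+1 j + j.+1%:R * W i j.+1).
  have nz k : k.+1%:R != 0 :> R by rewrite pnatr_eq0.
  rewrite [W i j.+1](eq_avg _ (fun a => avgS j _)) [W i.+1 j]avgS.
  rewrite [X in _ = _ * (X + _)](_ : _ =
    avg i (fun a => avg j (fun b => \sum_(x <- growths a) F (Join x b)))).
    rewrite [X in _ = _ * (_ + X)](_ : _ =
      avg i (fun a => avg j (fun b => \sum_(x <- growths b) F (Join a x)))).
      rewrite -avgD -avgZ; apply: eq_avg => a.
      rewrite -avgD -avgZ; apply: eq_avg => b /=.
      by rewrite big_cat !big_map.
    rewrite -avgZ; apply: eq_avg => a; rewrite -avgZ; apply: eq_avg => b.
    by rewrite mulVKf.
  rewrite -avgZ; apply: eq_avg => a; rewrite mulVKf //.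
  by rewrite /avg exchange_big mulr_suml.
rewrite avgS IH; under eq_bigr do rewrite WS.
rewrite -mulr_sumr mulrCA; congr (_ * _).
(* The cut with [j] and [m.+1 - j] attachments arises by growth of the first
   side, with weight [j], or of the second, with weight [m.+1 - j]; the total
   weight does not depend on [j]. *)
suff -> : \sum_(i < m.+1) (i.+1%:R * W i.+1 (m - i)%N +
            (m - i).+1%:R * W i (m - i).+1) =
          m.+1%:R * \sum_(i < m.+2) W i (m.+1 - i)%N.
  by rewrite mulKf // pnatr_eq0.
rewrite big_split /= mulr_sumr.
rewrite (eq_bigr (fun i : 'I_m.+2 => i%:R * W i (m.+1 - i)%N +
    (m.+1 - i)%:R * W i (m.+1 - i)%N)); last first.
  by move=> i _; rewrite -mulrDl -natrD subnKC // -ltnS.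
rewrite big_split /=; congr (_ + _).
  rewrite [RHS]big_ord_recl mul0r add0r.
  by apply: eq_bigr => i _; rewrite /= subSS.
rewrite [RHS]big_ord_recr /= subnn mul0r addr0.
by apply: eq_bigr => i _; rewrite subSn // -ltnS.
Qed.

Lemma avg_cst m (c : R) : avg m (fun=> c) = c.
Proof.
elim/ltn_ind: m => -[_|m IH]; first exact: avg0.
rewrite avg_join (eq_bigr (fun=> c)) => [|i _].
  by rewrite sumr_const card_ord -[X in _ * X]mulr_natl mulKf // pnatr_eq0.
rewrite -[RHS](IH i) //; apply: eq_avg => a; apply: IH.
by rewrite ltnS leq_subr.
Qed.

(** The arguments count attachments: the trees have [i.+1] and [j.+1]
    vertices. *)
Definition mean_overlap (i j : nat) : R :=
  avg i (fun t => avg j (fun s => (overlap t s)%:R)).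

Lemma mean_overlap0n j : mean_overlap 0 j = 1.
Proof.
rewrite /mean_overlap avg0 -[RHS](avg_cst j); apply: eq_avg => s.
by rewrite overlap_vertexl.
Qed.

Lemma mean_overlapn0 i : mean_overlap i 0 = 1.
Proof.
rewrite -[RHS](avg_cst i); apply: eq_avg => t.
by rewrite avg0 overlap_vertexr.
Qed.

(** Both trees are cut; the sides are superposed in pairs, and the two pairs of
    sides contribute equally by the symmetry of the cut. *)
Lemma mean_overlap_rec i j :
  mean_overlap i.+1 j.+1 = 2 / (i.+1%:R * j.+1%:R) *
    \sum_(a < i.+1) \sum_(b < j.+1) mean_overlap a b.
Proof.
transitivity (i.+1%:R^-1 * \sum_(a < i.+1) (j.+1%:R^-1 *
    \sum_(b < j.+1) (mean_overlap a b + mean_overlap (i - a)%N (j - b)%N))).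
  rewrite {1}/mean_overlap avg_join; congr (_ * _); apply: eq_bigr => a _.
  transitivity (avg a (fun x => j.+1%:R^-1 * \sum_(b < j.+1)
      (avg b (fun z => (overlap x z)%:R) + mean_overlap (i - a)%N (j - b)%N))).
    apply: eq_avg => x.
    transitivity (avg (i - a)%N (fun y => j.+1%:R^-1 * \sum_(b < j.+1)
       (avg b (fun z => (overlap x z)%:R) +
        avg (j - b)%N (fun w => (overlap y w)%:R)))).
      apply: eq_avg => y; rewrite avg_join; congr (_ * _).
      apply: eq_bigr => b _.
      transitivity (avg b (fun z => (overlap x z)%:R +
          avg (j - b)%N (fun w => (overlap y w)%:R))).
        apply: eq_avg => z; rewrite -[X in _ = X + _](avg_cst (j - b)%N) -avgD.
        by apply: eq_avg => w; rewrite overlap_join natrD.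
      by rewrite avgD avg_cst.
    rewrite avgZ avg_sum; congr (_ * _); apply: eq_bigr => b _.
    by rewrite avgD avg_cst.
  rewrite avgZ avg_sum; congr (_ * _); apply: eq_bigr => b _.
  by rewrite avgD avg_cst.
under eq_bigr do rewrite big_split mulrDr /=.
rewrite big_split -!mulr_sumr /=.
rewrite [X in _ + X](_ : _ =
  j.+1%:R^-1 * \sum_(a < i.+1) \sum_(b < j.+1) mean_overlap a b).
  by rewrite invfM; ring.
congr (_ * _); rewrite [RHS](reindex_inj rev_ord_inj) /=.
apply: eq_bigr => a _; rewrite [RHS](reindex_inj rev_ord_inj) /=.
by apply: eq_bigr => b _; rewrite !subSS.
Qed.

End Average.

(** * Solving the recursion *)

Section MinSums.
Variable R : comNzRingType.

Lemma sum_min_row (g : nat -> R) (n m : nat) : (n <= m)%N ->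
  \sum_(b < m) g (minn n b) = \sum_(b < n) g b + (m%:R - n%:R) * g n.
Proof.
move=> nm; rewrite -(big_mkord xpredT (fun b => g (minn n b))).
rewrite -(big_mkord xpredT g).
rewrite [LHS](big_cat_nat (n := n)) //=; congr (_ + _).
  by apply: eq_big_nat => b /andP[_ bn]; rewrite (minn_idPr (ltnW bn)).
rewrite (eq_big_nat _ _ (F2 := fun=> g n)) => [|b /andP[nb _]].
  by rewrite sumr_const_nat -natrB // mulr_natl.
by rewrite (minn_idPl nb).
Qed.

(** The number of pairs [(x, y)] with [x < n], [y < m] and minimum [a < n] is
    [n + m - (2 a + 1)]. *)
Lemma sum_min (g : nat -> R) (n m : nat) : (n <= m)%N ->
  \sum_(a < n) \sum_(b < m) g (minn a b) =
  \sum_(a < n) (n%:R + m%:R - (2 * a + 1)%:R) * g a.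
Proof.
elim: n => [|n IH] nm; first by rewrite !big_ord0.
rewrite !big_ord_recr /= IH 1?ltnW // sum_min_row 1?ltnW // addrA -big_split /=.
congr (_ + _); last by rewrite natrD natrM -natr1; ring.
by apply: eq_bigr => a _; rewrite -natr1; ring.
Qed.

End MinSums.

Section CubeRoot.
Variable R : realType.

Definition cbrt (n : nat) : R := n%:R `^ 3^-1.

Lemma cbrt_ge0 n : 0 <= cbrt n.
Proof. exact: powR_ge0. Qed.

Lemma cbrtK n : cbrt n ^+ 3 = n%:R.
Proof.
by rewrite -powR_mulrn ?cbrt_ge0 // -powRrM mulVf ?powRr1.
Qed.

(** With [r] the cube root of [k / n], the claim is that the quintic
    [1 - 5/2 r^2 + 2 r^5] is nonnegative.  A quadratic minorant of the cube root
    reduces the sums below to sums of powers; this one still leaves the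
    factor [2 (5/2 * 1/3 - 2 * 1/6) = 1] for twice the mean of the minimum of
    two uniform variables on the unit interval, the first two moments of this
    minimum being [1/3] and [1/6]. *)
Lemma cbrt_quadratic_lb (k n : nat) : (0 < n)%N ->
  cbrt n * (5 / 2 * (k%:R / n%:R) - 2 * (k%:R / n%:R) ^+ 2) <= cbrt k.
Proof.
move=> n0.
have y0 : 0 < cbrt n by rewrite powR_gt0 // ltr0n.
set r := cbrt k / cbrt n.
have r0 : 0 <= r by rewrite divr_ge0 // cbrt_ge0.
have -> : k%:R / n%:R = r ^+ 3 by rewrite /r expr_div_n !cbrtK.
have -> : cbrt k = cbrt n * r by rewrite /r mulrCA divff ?gt_eqF // mulr1.
rewrite ler_pM2l //; clearbody r.
(* Twice the product is [2 r^5 - 64/25 r^2 + 3072/3125], below the quintic and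
   touching zero at [4/5], close to the minimum of the quintic. *)
have q : 0 <= (r - 4 / 5) ^+ 2 *
    (r ^+ 3 + 8 / 5 * r ^+ 2 + 48 / 25 * r + 96 / 125).
  by rewrite mulr_ge0 ?sqr_ge0 // !addr_ge0 ?mulr_ge0 ?exprn_ge0.
have p : 0 <= 1 - 5 / 2 * r ^+ 2 + 2 * r ^+ 5.
  by have := sqr_ge0 r; lra.
rewrite -subr_ge0.
suff -> : r - (5 / 2 * r ^+ 3 - 2 * (r ^+ 3) ^+ 2) =
  r * (1 - 5 / 2 * r ^+ 2 + 2 * r ^+ 5) by rewrite mulr_ge0.
by ring.
Qed.

Lemma sum_weighted_quadratic (K x y : R) (n : nat) :
  \sum_(a < n) (K - (2 * a + 1)%:R) * (x * a.+1%:R - y * a.+1%:R ^+ 2) =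
  (K + 1) * (x * (n%:R * (n%:R + 1) / 2) -
             y * (n%:R * (n%:R + 1) * (2 * n%:R + 1) / 6))
  - 2 * x * (n%:R * (n%:R + 1) * (2 * n%:R + 1) / 6)
  + 2 * y * (n%:R * (n%:R + 1) / 2) ^+ 2.
Proof.
elim: n => [|n IH]; first by rewrite big_ord0; field.
by rewrite big_ord_recr /= IH natrD natrM -!natr1; field.
Qed.

(** If [K] and [L] are uniform on the first [n] and the first [m] positive
    integers, then twice the mean of the cube root of their minimum is at least
    the cube root of [n.+1].  With the quadratic minorant, the excess of the
    right-hand side is [n (m - n + 1 + 4 m / (n + 1)) / 6] cube roots
    of [n.+1]. *)
Lemma cbrt_sum_min_le (n m : nat) : (n <= m)%N ->
  n%:R * m%:R * cbrt n.+1 <=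
  2 * \sum_(a < n) \sum_(b < m) cbrt (minn a b).+1.
Proof.
move=> nm; rewrite (sum_min (fun a => cbrt a.+1)) //.
have N0 : 0 <= n%:R :> R by exact: ler0n.
have NM : n%:R <= m%:R :> R by rewrite ler_nat.
have n1 : 0 < n%:R + 1 :> R by rewrite ltr_wpDl.
have n1' : n%:R + 1 != 0 :> R by rewrite gt_eqF.
set x := 5 / 2 / (n%:R + 1) : R; set y := 2 / (n%:R + 1) ^+ 2 : R.
apply: (@le_trans _ _ (2 * (cbrt n.+1 *
  \sum_(a < n) (n%:R + m%:R - (2 * a + 1)%:R) *
                (x * a.+1%:R - y * a.+1%:R ^+ 2)))); last first.
  rewrite ler_pM2l // mulr_sumr; apply: ler_sum => a _.
  rewrite mulrCA ler_wpM2l //.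
    rewrite subr_ge0 -natrD ler_nat; have := ltn_ord a; lia.
  apply: le_trans (cbrt_quadratic_lb _ (ltn0Sn n)).
  rewrite le_eqVlt; apply/orP; left; apply/eqP; congr (_ * _).
  by rewrite -[in RHS]natr1 /x /y; field.
rewrite mulrCA [leLHS]mulrC ler_wpM2l ?cbrt_ge0 //.
rewrite sum_weighted_quadratic /x /y -subr_ge0.
rewrite [X in 0 <= X](_ : _ =
  n%:R * (m%:R - n%:R + 1 + 4 * m%:R / (n%:R + 1)) / 6).
  rewrite divr_ge0 // mulr_ge0 // addr_ge0 ?divr_ge0 //; lra.
by field.
Qed.

(** The recursion is monotone in the earlier values, so it turns the bound at
    smaller sizes into the double sum of [cbrt_sum_min_le]; that lemma applies
    after exchanging the two trees if the first is the larger one. *)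
Lemma mean_overlap_ge (i j : nat) : cbrt (minn i j).+1 <= mean_overlap R i j.
Proof.
elim/ltn_ind: i j => -[|i] IH [|j].
- by rewrite mean_overlap0n /cbrt powR1.
- by rewrite mean_overlap0n min0n /cbrt powR1.
- by rewrite mean_overlapn0 minn0 /cbrt powR1.
have pos : 0 < i.+1%:R * j.+1%:R :> R by rewrite mulr_gt0.
rewrite mean_overlap_rec minnSS mulrAC ler_pdivlMr // mulrC.
apply: (@le_trans _ _
  (2 * \sum_(a < i.+1) \sum_(b < j.+1) cbrt (minn a b).+1)).
  case: (leqP i j) => ij; first exact: cbrt_sum_min_le.
  rewrite exchange_big [X in X * cbrt _]mulrC /=.
  under eq_bigr do under eq_bigr do rewrite minnC.
  by apply: cbrt_sum_min_le; exact: ltnW.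
rewrite ler_pM2l //; apply: ler_sum => a _; apply: ler_sum => b _.
exact: IH.
Qed.

Lemma natmul_ln n (x : R) : 0 < x -> n%:R * ln x = ln (x ^+ n).
Proof. by move=> x0; rewrite lnXn // mulr_natl. Qed.

(** This is [(5/4)^3 <= 2]. *)
Lemma log2_54_le : log2 (5 / 4 : R) <= 3^-1.
Proof.
rewrite /log2 ler_pdivrMr ?ln_gt0 ?ltr1n // ler_pdivlMl //.
by rewrite natmul_ln // ler_ln ?posrE ?exprn_gt0 //; lra.
Qed.

(** This is [2^8 <= (5/4)^25]. *)
Lemma log2_54_ge : 32 / 100 <= log2 (5 / 4 : R).
Proof.
rewrite /log2 ler_pdivlMr ?ln_gt0 ?ltr1n //.
suff : 8 * ln (2 : R) <= 25 * ln (5 / 4 : R) by lra.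
by rewrite !natmul_ln // ler_ln ?posrE ?exprn_gt0 //; lra.
Qed.

End CubeRoot.

(** * From growth histories to the uniform attachment law *)

Section Sprout.
Variable L : eqType.
Implicit Types t : rtree L.

(** Attaches [w] to [v].  The new child enters at the innermost [Join] of [v],
    so the cuts already made stay in place, and the outermost one at a vertex
    always goes to its oldest child. *)
Fixpoint sprout (v w : L) t : rtree L :=
  match t with
  | Vertex x => if x == v then Join (Vertex x) (Vertex w) else Vertex x
  | Join a b => Join (sprout v w a) (sprout v w b)
  end.

Lemma root_sprout v w t : root (sprout v w t) = root t.
Proof. by elim: t => //= x; case: eqP. Qed.

Lemma sprout_id v w t : v \notin labels t -> sprout v w t = t.
Proof.
elim: t => /= [x|a IHa b IHb].
  by rewrite inE eq_sym => /negbTE->.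
by rewrite mem_cat negb_or => /andP[/IHa-> /IHb->].
Qed.

Lemma perm_sprout v w t : uniq (labels t) -> v \in labels t ->
  perm_eq (labels (sprout v w t)) (w :: labels t) /\
  perm_eq (arcs (sprout v w t)) ((v, w) :: arcs t).
Proof.
elim: t => [x|a IHa b IHb] /=.
  rewrite inE => _ /eqP->; rewrite eqxx /=; split=> //.
  exact/permPl/(perm_catC [:: _] [:: _]).
rewrite cat_uniq mem_cat => /and3P[ua dis ub] v_in.
have [va|va] := boolP (v \in labels a).
  have vb : v \notin labels b by apply: contra dis => vb; apply/hasP; exists v.
  have [pl pa] := IHa ua va.
  rewrite (sprout_id w vb) root_sprout; split.
    by rewrite -cat_cons perm_cat2r.
  rewrite -[_ :: _ :: _]/([:: _] ++ [:: _] ++ _) perm_sym perm_catCA /=.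
  by rewrite perm_cons perm_sym -cat_cons perm_cat2r.
have vb : v \in labels b by case/orP: v_in => //; rewrite (negbTE va).
have [pl pa] := IHb ub vb.
rewrite (sprout_id w va) root_sprout; split.
  by rewrite -cat1s perm_sym perm_catCA perm_cat2l perm_sym.
rewrite -[_ :: _ :: _]/([:: _] ++ [:: _] ++ _) perm_sym perm_catCA /=.
by rewrite perm_cons perm_sym -cat1s perm_sym perm_catCA perm_cat2l perm_sym.
Qed.

(** Forgetting the labels is harmless because the overlap depends on shapes
    only. *)
Definition shape t : rtree unit := relabel (fun=> tt) t.

Lemma growths_shape w t : uniq (labels t) ->
  growths (shape t) = [seq shape (sprout v w t) | v <- labels t].
Proof.
elim: t => [x|a IHa b IHb] /=; first by rewrite eqxx.
rewrite cat_uniq map_cat => /and3P[ua dis ub].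
rewrite -/(shape a) -/(shape b) IHa // IHb // -!map_comp.
congr (_ ++ _); apply/eq_in_map => v vt /=; congr Join.
  rewrite sprout_id //; apply: contra dis => vb; apply/hasP; by exists v.
rewrite sprout_id //; apply: contra dis => va; apply/hasP; by exists v.
Qed.

End Sprout.

Section Attach.
Variable m : nat.
Implicit Types t : rtree 'I_m.

Definition grow t (v : 'I_m) : rtree 'I_m.+1 :=
  sprout (widen_ord (leqnSn m) v) ord_max (relabel (widen_ord (leqnSn m)) t).

Lemma widen_inj : injective (widen_ord (leqnSn m)).
Proof. by move=> i j /(congr1 val) /= e; apply: val_inj. Qed.

Lemma labels_grow t v : uniq (labels t) -> v \in labels t ->
  perm_eq (labels (grow t v))
    (ord_max :: map (widen_ord (leqnSn m)) (labels t)).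
Proof.
move=> u vt; rewrite -labels_relabel; apply: (perm_sprout _ _ _).1;
  by rewrite labels_relabel ?map_inj_uniq ?mem_map //; exact: widen_inj.
Qed.

Lemma grow_uniq t v : uniq (labels t) -> v \in labels t ->
  uniq (labels (grow t v)).
Proof.
move=> u vt; rewrite (perm_uniq (labels_grow u vt)) /=.
rewrite map_inj_uniq ?u ?andbT; last exact: widen_inj.
by apply/mapP => -[i _] /(congr1 val) /= e; have := ltn_ord i; rewrite -e ltnn.
Qed.

Lemma grow_full t v : uniq (labels t) -> (forall x, x \in labels t) ->
  forall x, x \in labels (grow t v).
Proof.
move=> u full x; rewrite (perm_mem (labels_grow u (full v))) in_cons.
have [//|xm] := eqVneq x ord_max.
have xlt : (x < m)%N by rewrite ltn_neqAle -ltnS ltn_ord andbT.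
by apply/mapP; exists (Ordinal xlt) => //; exact: val_inj.
Qed.

Lemma attach_graph_of t v : uniq (labels t) -> v \in labels t ->
  attach (graph_of t) v = graph_of (grow t v).
Proof.
move=> u vt; congr (_, _); apply/setP => z.
  rewrite !inE (perm_mem (labels_grow u vt)) in_cons; congr (_ || _).
  by apply/imsetP/mapP => -[x xt ->]; exists x => //; move: xt; rewrite inE.
have pa : arcs (grow t v) =i (widen_ord (leqnSn m) v, ord_max) ::
    [seq (widen_ord (leqnSn m) e.1, widen_ord (leqnSn m) e.2) | e <- arcs t].
  apply/perm_mem; rewrite -arcs_relabel; apply: (perm_sprout _ _ _).2;
    by rewrite labels_relabel ?map_inj_uniq ?mem_map //; exact: widen_inj.
have pair_im x y : [set widen_ord (leqnSn m) k | k in [set x; y]%SET]%SET =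
    [set widen_ord (leqnSn m) x; widen_ord (leqnSn m) y]%SET.
  by rewrite imsetU1 imset_set1.
rewrite !inE; apply/orP/imsetP => /=.
- case=> [/eqP->|/imsetP[e /imsetP[[p c] pc ->] ->]] /=.
    by exists (widen_ord (leqnSn m) v, ord_max); rewrite ?pa ?mem_head.
  exists (widen_ord (leqnSn m) p, widen_ord (leqnSn m) c); last first.
    by rewrite pair_im.
  by rewrite pa in_cons; apply/orP; right; apply/mapP; exists (p, c).
- case=> -[p c]; rewrite pa in_cons => /orP[/eqP[-> ->] ->|]; first by left.
  case/mapP => -[q d] qd [-> ->] -> /=; right.
  apply/imsetP; exists [set q; d]%SET; last by rewrite pair_im.
  by apply/imsetP; exists (q, d).
Qed.

End Attach.

Section Law.
Variable R : realType.

Lemma sum_attach_prob m (H : graph 'I_m) (f : graph 'I_m.+1 -> R) :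
  \sum_G attach_prob R H G * f G =
  #|verts H|%:R^-1 * \sum_(v in verts H) f (attach H v).
Proof.
rewrite (partition_big (attach H) xpredT) //= mulr_sumr.
apply: eq_bigr => G _; rewrite /attach_prob -mulrA mulrCA; congr (_ * _).
rewrite (eq_bigr (fun=> f G)) => [|v /andP[_ /eqP->] //].
by rewrite sumr_const mulr_natl cardsE.
Qed.

(** Induction on the number of vertices: one step of the attachment law and one
    step of [avg] both average over the vertex that receives the new one, and
    they are matched tree by tree through [attach_graph_of]. *)
Lemma avg_le_ua_law m (F : rtree unit -> R) (f : graph 'I_m.+1 -> R) :
  (forall t : rtree 'I_m.+1, uniq (labels t) -> (forall x, x \in labels t) ->
     F (shape t) <= f (graph_of t)) ->
  avg m F <= \sum_G ua_law_succ R G * f G.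
Proof.
elim: m F f => [|m IH] F f Ff.
  rewrite avg0 (bigD1 single_vertex) //= eqxx mul1r big1 ?addr0; last first.
    by move=> G /negbTE->; rewrite mul0r.
  have -> : single_vertex = graph_of (Vertex (ord0 : 'I_1)).
    congr (_, _); apply/setP => x; rewrite !inE.
      by rewrite (ord1 x) eqxx.
    by apply/esym/imsetP => -[].
  by apply: (Ff (Vertex ord0)) => // x; rewrite (ord1 x) mem_head.
rewrite avgS /=.
under eq_bigr do rewrite mulr_suml.
rewrite exchange_big /=.
under eq_bigr do under eq_bigr do rewrite -mulrA.
under eq_bigr do rewrite -mulr_sumr sum_attach_prob.
apply: IH => t u full.
have card_t : size (labels t) = m.+1.
  rewrite -(card_verts u) -[RHS]card_ord; apply: eq_card => x.
  by rewrite in_verts full.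
rewrite card_verts // card_t ler_pM2l ?invr_gt0 ?ltr0n //.
rewrite (growths_shape ord0 u) big_map.
rewrite [leRHS](eq_bigl (mem (labels t))) => [|x]; last exact: in_verts.
rewrite -big_uniq //= big_seq [leRHS]big_seq; apply: ler_sum => v vt.
rewrite attach_graph_of // -(_ : shape (grow t v) = shape (sprout v ord0 t)).
  by apply: Ff; [exact: grow_uniq|exact: grow_full].
rewrite /shape /grow.
elim: {u full card_t vt} t => [x|a IHa b IHb] /=; last by rewrite IHa IHb.
by rewrite (inj_eq (@widen_inj _)); case: eqP.
Qed.

End Law.

(** * Expectation of a function of two independent finite variables *)

Lemma expectation_finite_pair (R : realType) (d : measure_display)
    (Omega : measurableType d) (P : probability Omega R) (A B : finType)
    (S : Omega -> A) (T : Omega -> B) (p : A -> R) (q : B -> R)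
    (h : A -> B -> R) :
  (forall C : set A, measurable (S @^-1` C)%classic) ->
  (forall D : set B, measurable (T @^-1` D)%classic) ->
  (forall a, P (S @^-1` [set a])%classic = (p a)%:E) ->
  (forall b, P (T @^-1` [set b])%classic = (q b)%:E) ->
  independent_rv P S T -> (forall a b, 0 <= h a b) ->
  ('E_P[fun w => h (S w) (T w)] = (\sum_a p a * \sum_b q b * h a b)%R%:E)%E.
Proof.
move=> mS mT pS qT ind h0.
pose E (ab : A * B) := (S @^-1` [set ab.1] `&` T @^-1` [set ab.2])%classic.
have mE ab : measurable (E ab) by apply: measurableI; [exact: mS|exact: mT].
rewrite unlock /expectation.
transitivity (\int[P]_w \sum_(ab : A * B) (h ab.1 ab.2 * \1_(E ab) w)%:E)%E.
  apply: eq_integral => w _; rewrite sumEFin; congr EFin.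
  rewrite (bigD1 (S w, T w)) //= big1 ?addr0 => [|[a b] /= ne].
    by rewrite indicE mem_set ?mulr1.
  rewrite indicE memNset ?mulr0 // => -[/= Sa Tb].
  by move/eqP: ne; rewrite Sa Tb.
rewrite ge0_integral_sum //; first last.
- by move=> [a b] w _; rewrite lee_fin mulr_ge0 // indicE.
- by move=> ab; apply/measurable_EFinP; exact: measurable_funM.
have -> : \sum_a p a * \sum_b q b * h a b =
    \sum_(ab : A * B) p ab.1 * (q ab.2 * h ab.1 ab.2).
  by under eq_bigr do rewrite mulr_sumr; rewrite pair_bigA.
rewrite -sumEFin; apply: eq_bigr => -[a b] _ /=.
under eq_integral do rewrite EFinM.
have mI : measurable_fun setT (EFin \o (\1_(E (a, b)) : Omega -> R)).
  by apply/measurable_EFinP; exact: measurable_indic.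
rewrite (ge0_integralZl _ _ mI) ?lee_fin //; last first.
  by move=> w _; rewrite lee_fin indicE.
rewrite integral_indic // setIT /E /= ind // pS qT -!EFinM; congr EFin.
by rewrite mulrC mulrA.
Qed.

(** * The expected size of the largest common subtree *)

Lemma mean_overlap_le_law (R : realType) (m : nat) :
  mean_overlap R m m <=
  \sum_G ua_law_succ R G *
    \sum_H ua_law_succ R H * (@largest_common_subtree 'I_m.+1 'I_m.+1 G H)%:R.
Proof.
apply: avg_le_ua_law => t ut _.
apply: (avg_le_ua_law (F := fun s => (overlap (shape t) s)%:R)) => s us _.
by rewrite overlap_relabel ler_nat; exact: overlap_le_largest.
Qed.

Theorem claim2p1 (R : realType) (d : measure_display) (Omega : measurableType d)
    (P : probability Omega R) (n : nat) (hn : (1 <= n)%N)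
    (T1 T2 : Omega -> graph 'I_n)
    (hT1 : uniform_attachment_tree P T1) (hT2 : uniform_attachment_tree P T2)
    (hind : independent_rv P T1 T2) :
  let X : Omega -> R := fun w => (largest_common_subtree (T1 w) (T2 w))%:R in
  ((n%:R `^ log2 (5 / 4 : R))%:E <= 'E_P[X])%E /\
  n%:R `^ (32 / 100) <= n%:R `^ log2 (5 / 4 : R).
Proof.
case: n hn T1 T2 hT1 hT2 hind => // m _ T1 T2 [mT1 lT1] [mT2 lT2] hind X.
have n1 : 1 <= m.+1%:R :> R by rewrite ler1n.
split; last by rewrite ler_powR // log2_54_ge.
rewrite (expectation_finite_pair mT1 mT2 lT1 lT2 hind
  (h := fun G H => (largest_common_subtree G H)%:R)) // lee_fin.
apply: le_trans (mean_overlap_le_law R m).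
apply: le_trans (mean_overlap_ge R m m).
by rewrite minnn ler_powR // log2_54_le.
Qed.
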